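(* (a) Let $K\subset\mathbb{R}^d$ be a closed convex cone with vertex at the origin and non-empty interior, such that there is a hyperplane $\pi$ with $\pi\cap K=\{0\}$ and $K\setminus\{0\}$ contained in one of the open halfspaces determined by $\pi$. Let $\mathcal{V}$ be the family of all closed intervals with respect to the partial order $x\preceq y\iff y-x\in K$, let $\mathcal{U}$ be the family of complements of sets in $\mathcal{V}$, and let $\mathcal{H}$ be the family of all closed halfspaces (on either side) bounded by hyperplanes tangent to $K$, and all their translations. Then for every probability measure $P$ on the Borel sets of $\mathbb{R}^d$ and every $x\in\mathbb{R}^d$, $$D(x;P,\mathcal{U})=D(x;P,\mathcal{H}).$$ In particular, if $\mathcal{V}$ is the family of intervals with respect to the coordinate-wise partial order ($x\preceq y\iff x_i\le y_i$, $i=1,\dots,d$), then the corresponding depth function $D(\cdot\,;P,\mathcal{U})$ is the same as the depth function generated by the closed halfspaces with borders parallel to the coordinate hyperplanes. (b) Let $\mathcal{H}$ be the family of all closed halfspaces in $\mathbb{R}^d$, let $\mathcal{U}_k$ be the family of complements of all compact convex sets in $\mathbb{R}^d$, and let $\mathcal{U}_b$ be the family of complements of all closed balls in $\mathbb{R}^d$. Then for every probability measure $P$ on the Borel sets of $\mathbb{R}^d$ and every $x\in\mathbb{R}^d$, $$D(x;P,\mathcal{H})=D(x;P,\mathcal{U}_k)=D(x;P,\mathcal{U}_b).$$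
   Context: For a collection $\mathcal{C}$ of Borel subsets of $\mathbb{R}^d$, $D(x;P,\mathcal{C})=\inf\{P(C): x\in C\in\mathcal{C}\}$. Intervals for the order induced by the cone $K$: for $a,b\in\mathbb{R}^d$, $[a,b]=\{x\in\mathbb{R}^d: x-a\in K,\ b-x\in K\}=(a+K)\cap(b-K)$; intervals with endpoints having infinite coordinates are $a+K$ (upper endpoint not in $\mathbb{R}^d$), $b-K$ (lower endpoint not in $\mathbb{R}^d$), or $\mathbb{R}^d$ (neither endpoint in $\mathbb{R}^d$). For the coordinate-wise order, an interval with endpoints $a,b\in(\mathbb{R}\cup\{\pm\infty\})^d$ is $\{x\in\mathbb{R}^d: a_i\le x_i\le b_i,\ i=1,\dots,d\}$. A hyperplane is tangent to $K$ if it is the unique supporting hyperplane of $K$ at some point of $K$. *)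

(* Defs.v *)
From HB Require Import structures.
From mathcomp Require Import all_boot all_order all_algebra.
From mathcomp Require Import all_classical all_reals all_analysis.
Import Order.TTheory GRing.Theory Num.Theory.
Import numFieldNormedType.Exports.

Set Implicit Arguments.
Unset Strict Implicit.
Unset Printing Implicit Defensive.

Local Open Scope classical_set_scope.
Local Open Scope ring_scope.

(* The product topology on ['rV[R]_d] is the usual topology of R^d, so its
   open sets generate the usual Borel sets. *)
Definition borel_rV (R : realType) (d : nat) :=
  g_sigma_algebraType (@open 'rV[R]_d).

Section Geometry.
Variables (R : realType) (d : nat).
Local Notation V := 'rV[R]_d.
Implicit Types (x y u v c : V) (r t b : R) (K S A B : set V) (F : set (set V)).

Definition dot x y : R := \sum_(i < d) x 0 i * y 0 i.

(* The library norm on matrices is the sup norm, hence a separate Euclidean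
   norm. *)
Definition enorm x : R := Num.sqrt (dot x x).

Definition translate v A : set V := [set x : V | A (x - v)].

Definition hyperplane u b : set V := [set x : V | dot u x = b].

(* The other side of [hyperplane u b] is [halfspace (- u) (- b)]. *)
Definition halfspace u b : set V := [set x : V | dot u x <= b].

Definition complements F : set (set V) := [set ~` A | A in F].

Definition cone K : Prop := forall t x, 0 <= t -> K x -> K (t *: x).

Definition one_sided_cone K : Prop :=
  exists u b, [/\ u != 0, hyperplane u b `&` K = [set 0] &
    K `\ 0 `<=` [set x : V | dot u x < b] \/ K `\ 0 `<=` [set x : V | b < dot u x]].

(* Containment in [halfspace u b] covers both sides, as [u] may be negated. *)
Definition supporting K y (H : set V) : Prop :=
  H y /\ exists u b, [/\ u != 0, H = hyperplane u b & K `<=` halfspace u b].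

Definition tangent K (H : set V) : Prop :=
  exists y, [/\ K y, supporting K y H &
    forall H', supporting K y H' -> H' = H].

Definition tangent_halfspaces K : set (set V) :=
  [set S : set V | exists u b v,
     [/\ u != 0, tangent K (hyperplane u b) & S = translate v (halfspace u b)]].

Definition cone_le K x y : Prop := K (y - x).

(* An endpoint [None] is one that is not in R^d; it imposes no constraint. *)
Definition cone_interval K (lo hi : option V) : set V :=
  [set x : V | (if lo is Some p then cone_le K p x else True) /\
               (if hi is Some q then cone_le K x q else True)].

Definition cone_intervals K : set (set V) :=
  [set S : set V | exists lo hi, S = cone_interval K lo hi].

Definition coord_interval (lo hi : 'rV[\bar R]_d) : set V :=
  [set x : V | forall i : 'I_d, (lo 0%R i <= (x 0%R i)%:E <= hi 0%R i)%E].

Definition coord_intervals : set (set V) :=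
  [set S : set V | exists lo hi, S = coord_interval lo hi].

Definition parallel A B : Prop := exists v, A = translate v B.

Definition coord_halfspaces : set (set V) :=
  [set S : set V | exists u b (i : 'I_d), [/\ u != 0, S = halfspace u b &
     parallel (hyperplane u b) [set x : V | x 0 i = 0]]].

Definition closed_halfspaces : set (set V) :=
  [set S : set V | exists u b, u != 0 /\ S = halfspace u b].

Definition compact_convex_sets : set (set V) :=
  [set S : set V | compact S /\ convex_set S].

Definition closed_euclidean_balls : set (set V) :=
  [set S : set V | exists c r, 0 < r /\ S = [set x : V | enorm (x - c) <= r]].

End Geometry.

Arguments coord_intervals : clear implicits.
Arguments coord_halfspaces : clear implicits.
Arguments closed_halfspaces : clear implicits.
Arguments compact_convex_sets : clear implicits.
Arguments closed_euclidean_balls : clear implicits.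

Definition depth (R : realType) (d : nat) (P : probability (borel_rV R d) R)
    (F : set (set 'rV[R]_d)) (x : 'rV[R]_d) : \bar R :=
  ereal_inf [set P A | A in [set A : set 'rV[R]_d | F A /\ A x]].

(* Main.v *)
Require Import Defs.
From HB Require Import structures.
From mathcomp Require Import all_boot all_order all_algebra.
From mathcomp Require Import all_classical all_reals all_analysis.
From mathcomp Require Import ring lra.
Import Order.TTheory GRing.Theory Num.Theory.
Import numFieldNormedType.Exports.

(** Write [D F] for the depth generated by a family [F].  Each equality is two
inequalities, obtained in the same way in all three settings.

To get [D G x <= D F x] when [F] consists of complements of closed convex
sets [I] and [G] of halfspaces, a halfspace in [G] is found that contains [x]
and misses [I]; it then has smaller mass than the complement of [I]
([depth_le_sub]).  For the converse, the open halfspace complementary to a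
member [S] of [G] is written as an increasing union of sets whose complements
are in [F]; continuity of [P] along this union makes the masses of the
complements tend to [P S] ([depth_le_exhaustion]).

For compact convex sets the separating halfspace comes from the nearest point
([nearest_point_separation]), and an open halfspace is the increasing union of
balls whose centres and radii run to infinity ([ball_exhaustion]).  For
coordinate intervals it is enough to look at the one coordinate that is
violated, and intervals with a single finite endpoint exhaust a halfspace.

The cone is where tangency matters.  A point [x] outside the interval
[[a, b]] has [x - a] or [b - x] outside [K], and this point has to be separated
from [K] strictly by a hyperplane that is tangent, not merely supporting
([tangent_separation]).  Slide a small Euclidean ball from the interior of [K]
towards the outside point until it first touches the boundary.  At the point of
contact the ball, being smooth and inside [K], leaves only one possible
supporting hyperplane, so this hyperplane is tangent; it separates the outside
point as soon as the radius is small compared with the room left.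

For the exhaustion, let [v = 0] be tangent to [K] at [y0], with [v <= 0] on
[K].  The closed cone generated by [K] and [- y0] is supported only by that
hyperplane, hence it is the whole halfspace: moving any point with [v < 0]
along [y0] eventually brings it into [K] ([tangent_recession]).  Therefore the
one-ended intervals [b - K] fill [v > v p] when [b] runs to infinity along [y0]
while [v b] decreases to [v p] ([halfspace_exhaustion]).  The opposite side is
covered by intervals [a + K], by the symmetry [y -> - y]. *)

Set Implicit Arguments.
Unset Strict Implicit.
Unset Printing Implicit Defensive.

Local Open Scope classical_set_scope.
Local Open Scope ring_scope.

(** * The Euclidean structure of row vectors *)

Section Dot.
Variables (R : realType) (d : nat).
Local Notation V := 'rV[R]_d.
Implicit Types (x y z u v w c p : V) (K C : set V).

Lemma dotC x y : dot x y = dot y x.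
Proof. by apply: eq_bigr => i _; rewrite mulrC. Qed.

Lemma dotDl x y z : dot (x + y) z = dot x z + dot y z.
Proof. by rewrite -big_split; apply: eq_bigr => i _; rewrite mxE mulrDl. Qed.

Lemma dotZl a x y : dot (a *: x) y = a * dot x y.
Proof. by rewrite [RHS]mulr_sumr; apply: eq_bigr => i _; rewrite mxE mulrA. Qed.

Lemma dotNl x y : dot (- x) y = - dot x y.
Proof. by rewrite -scaleN1r dotZl mulN1r. Qed.

Lemma dotDr x y z : dot x (y + z) = dot x y + dot x z.
Proof. by rewrite !(dotC x) dotDl. Qed.

Lemma dotZr a x y : dot x (a *: y) = a * dot x y.
Proof. by rewrite !(dotC x) dotZl. Qed.

Lemma dotNr x y : dot x (- y) = - dot x y.
Proof. by rewrite !(dotC x) dotNl. Qed.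

Lemma dot0r x : dot x 0 = 0.
Proof. by rewrite -(scale0r 0) dotZr mul0r. Qed.

Definition dotE := (dotDl, dotDr, dotZl, dotZr, dotNl, dotNr).

Lemma dot_ge0 x : 0 <= dot x x.
Proof. by apply: sumr_ge0 => i _; rewrite -expr2 sqr_ge0. Qed.

Lemma dot_eq0 x : (dot x x == 0) = (x == 0).
Proof.
apply/eqP/eqP => [/eqP|->]; last exact: dot0r.
rewrite psumr_eq0 => [/allP x0|i _]; last by rewrite -expr2 sqr_ge0.
apply/rowP => i; rewrite mxE; apply/eqP; rewrite -sqrf_eq0 expr2.
exact: (implyP (x0 i (mem_index_enum _))).
Qed.

Lemma dot_gt0 x : (0 < dot x x) = (x != 0).
Proof. by rewrite lt_def dot_ge0 andbT dot_eq0. Qed.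

Lemma enorm_ge0 x : 0 <= enorm x.
Proof. exact: sqrtr_ge0. Qed.

Lemma enorm_sqr x : enorm x * enorm x = dot x x.
Proof. by rewrite -expr2 sqr_sqrtr // dot_ge0. Qed.

Lemma enorm_gt0 x : (0 < enorm x) = (x != 0).
Proof. by rewrite sqrtr_gt0 dot_gt0. Qed.

Lemma enorm_le_sqr x r : 0 <= r -> (enorm x <= r) = (dot x x <= r * r).
Proof.
move=> r0; rewrite -enorm_sqr -!expr2.
by rewrite ler_pXn2r // nnegrE // enorm_ge0.
Qed.

Lemma enorm_lt_sqr x r : 0 <= r -> (enorm x < r) = (dot x x < r * r).
Proof.
move=> r0; rewrite -enorm_sqr -!expr2.
by rewrite ltr_pXn2r // nnegrE // enorm_ge0.
Qed.

(** The Cauchy-Schwarz inequality. *)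
Lemma dot_le_enorm x y : dot x y <= enorm x * enorm y.
Proof.
have [->|x0] := eqVneq x 0.
  by rewrite dotC dot0r mulr_ge0 ?enorm_ge0.
have [->|y0] := eqVneq y 0.
  by rewrite dot0r mulr_ge0 ?enorm_ge0.
have := dot_ge0 (enorm y *: x - enorm x *: y).
rewrite !dotE (dotC y x) -!enorm_sqr.
move: x0 y0; rewrite -!enorm_gt0; set a := enorm x; set b := enorm y => a0 b0.
have ab0 : 0 < a * b by exact: mulr_gt0.
move=> H; rewrite -(ler_pM2l ab0); nra.
Qed.

Lemma dot_continuous u : continuous (fun x : V => dot u x).
Proof.
move=> x; rewrite /dot.
apply: (@cvg_big R^o _ _ _ _ (@add_continuous R^o) _ (nbhs x)) => i _.
apply: cvgM; first exact: cvg_cst.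
exact: coord_continuous.
Qed.

Lemma dot_sqr_continuous : continuous (fun x : V => dot x x).
Proof.
move=> x; rewrite /dot.
apply: (@cvg_big R^o _ _ _ _ (@add_continuous R^o) _ (nbhs x)) => i _.
apply: cvgM; exact: coord_continuous.
Qed.

Lemma normr_le_coord x r : 0 <= r -> (forall i, `|x 0 i| <= r) -> `|x| <= r.
Proof.
move=> r0 xr; rewrite /Num.norm /= mx_normrE.
by apply/bigmax_leP; split=> // -[i j] _ /=; rewrite ord1.
Qed.

(** The topology of row vectors is defined by the sup norm; this bound and the
continuity of [dot] transfer it to Euclidean balls. *)
Lemma normr_le_enorm x : `|x| <= enorm x.
Proof.
apply: normr_le_coord => [|i]; first exact: enorm_ge0.
rewrite -sqrtr_sqr ler_wsqrtr // /dot (bigD1 i) //= expr2 lerDl.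
by apply: sumr_ge0 => j _; rewrite -expr2 sqr_ge0.
Qed.

Lemma enormN x : enorm (- x) = enorm x.
Proof. by rewrite /enorm dotNl dotNr opprK. Qed.

Lemma enormZ a x : 0 <= a -> enorm (a *: x) = a * enorm x.
Proof.
move=> a0; rewrite /enorm dotZl dotZr mulrA -expr2.
by rewrite sqrtrM ?sqr_ge0 // sqrtr_sqr ger0_norm.
Qed.

Lemma enorm_triangle x y : enorm (x + y) <= enorm x + enorm y.
Proof.
rewrite enorm_le_sqr ?addr_ge0 ?enorm_ge0 // !dotE (dotC y x) -!enorm_sqr.
by have := dot_le_enorm x y; lra.
Qed.

Lemma dist_sqr_continuous c : continuous (fun y : V => dot (y - c) (y - c)).
Proof.
move=> y; apply: (@continuous_comp V V R (fun y => y - c) (fun x => dot x x)).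
  exact: (@cvgB _ V _ (nbhs y) _ id (fun=> c) y c cvg_id (cvg_cst c)).
exact: dot_sqr_continuous.
Qed.

Lemma open_eball c r : open [set y : V | dot (y - c) (y - c) < r].
Proof.
by have /continuousP /(_ _ (@open_lt _ r)) := @dist_sqr_continuous c.
Qed.

Lemma compact_eball c r : compact [set y : V | enorm (y - c) <= r].
Proof.
apply: bounded_closed_compact.
  exists (r + `|c|); split; first exact: num_real.
  move=> M rM y /= yr; have := ler_normD (y - c) c; rewrite subrK => yc.
  by have := normr_le_enorm (y - c); lra.
have [r0|r0] := leP 0 r; last first.
  rewrite [X in closed X](_ : _ = set0); first exact: closed0.
  by apply/seteqP; split=> // y /= yr; have := enorm_ge0 (y - c); lra.
rewrite [X in closed X](_ : _ = [set y : V | dot (y - c) (y - c) <= r * r]).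
  by have /continuous_closedP /(_ _ (@closed_le _ (r * r))) :=
    @dist_sqr_continuous c.
by apply/seteqP; split=> y /=; rewrite enorm_le_sqr.
Qed.

End Dot.

(** * Hyperplanes and halfspaces *)

Section Hyperplanes.
Variables (R : realType) (d : nat).
Local Notation V := 'rV[R]_d.
Implicit Types (u v : V) (K : set V).

Lemma hyperplaneZ a u b : a != 0 ->
  hyperplane (a *: u) (a * b) = hyperplane u b :> set V.
Proof.
by move=> a0; apply/seteqP; split=> x /=; rewrite /hyperplane /= dotZl;
  [move/(mulfI a0)|move->].
Qed.

(** A hyperplane determines its equation up to a factor.  The sign of the factor
stays free, which is why both sides of a tangent hyperplane occur below. *)
Lemma hyperplane_eq u v b c : u != 0 -> v != 0 ->
  hyperplane u b = hyperplane v c :> set V ->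
  exists a, [/\ a != 0, u = a *: v & b = a * c].
Proof.
move=> u0 v0 E.
have vv0 : dot v v != 0 by rewrite dot_eq0.
have inv x : dot v x = c -> dot u x = b.
  by have : hyperplane v c x -> hyperplane u b x by rewrite E.
pose p := (c / dot v v) *: v; pose a := dot u v / dot v v.
have vp : dot v p = c by rewrite /p dotZr divfK.
have [g gE] : exists g, g = u - a *: v by eexists.
have vg : dot v g = 0.
  by rewrite gE dotDr dotNr dotZr /a divfK // (dotC v) subrr.
have up := inv _ vp.
have ug : dot u g = 0.
  have : dot u (p + g) = b by apply: inv; rewrite dotDr vp vg addr0.
  by rewrite dotDr up; lra.
have g0 : g = 0.
  apply/eqP; rewrite -dot_eq0 {1}gE dotDl dotNl dotZl ug vg.
  by rewrite mulr0 subr0.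
have uE : u = a *: v by apply/eqP; rewrite -subr_eq0 -gE g0.
exists a; split => //.
  by apply/eqP => a0; move: u0; rewrite uE a0 scale0r eqxx.
by rewrite -up uE dotZl vp.
Qed.

Lemma halfspace_closed u b : closed (halfspace u b : set V).
Proof.
by have /continuous_closedP /(_ _ (@closed_le _ b)) := @dot_continuous R d u.
Qed.

Lemma translate_halfspace v u b :
  translate v (halfspace u b) = halfspace u (b + dot u v) :> set V.
Proof.
by apply/seteqP; split=> x; rewrite /translate /halfspace /= dotDr dotNr lerBlDr.
Qed.

(** Every parallel translate of a hyperplane is reached by moving along its
normal. *)
Lemma tangent_halfspaces_shift K u b c : u != 0 -> tangent K (hyperplane u b) ->
  tangent_halfspaces K (halfspace u c).
Proof.
move=> u0 tgt; exists u, b, (((c - b) / dot u u) *: u); split => //.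
by rewrite translate_halfspace dotZr divfK ?dot_eq0 // addrC subrK.
Qed.

End Hyperplanes.

(** * Convex sets *)

Section ConvexSets.
Variables (R : realType) (d : nat).
Local Notation V := 'rV[R]_d.
Implicit Types (x y z v c k : V) (K : set V).

Lemma interiorP K c :
  interior K c <-> exists2 r, 0 < r & forall y, enorm (y - c) < r -> K y.
Proof.
split=> [/nbhs_ballP[r /= r0 rK]|[r r0 rK]].
  exists r => // y yr; apply: rK; rewrite -ball_normE /ball_ /= distrC.
  exact: le_lt_trans (normr_le_enorm _) yr.
have : nbhs c [set y : V | dot (y - c) (y - c) < r * r].
  apply: open_nbhs_nbhs; split; first exact: open_eball.
  by rewrite /= subrr dot0r mulr_gt0.
by apply: filterS => y /= yr; apply: rK; rewrite enorm_lt_sqr // ltW.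
Qed.

(** Convexity with real coefficients instead of elements of a subtype of [R]. *)
Lemma convex_setP K : convex_set K <->
  forall x y t, 0 <= t -> t <= 1 -> K x -> K y -> K (t *: x + (1 - t) *: y).
Proof.
split=> [cK x y t t0 t1 Kx Ky|cK x y t]; last first.
  rewrite !inE => Kx Ky; apply: cK => //.
have t01 : Itv.spec (@Itv.num_sem R) (Itv.Real `[0%Z, 1%Z]) t.
  by rewrite /= /Itv.num_sem /= num_real in_itv /= t0 t1.
by have := cK x y (Itv.mk t01); rewrite !inE; apply.
Qed.

Lemma convex_eball c r : 0 <= r -> convex_set [set y : V | enorm (y - c) <= r].
Proof.
move=> r0; apply/convex_setP => x y t t0 t1 /= xr yr.
have -> : t *: x + (1 - t) *: y - c = t *: (x - c) + (1 - t) *: (y - c).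
  by apply/rowP => i; rewrite !mxE; ring.
apply: le_trans (enorm_triangle _ _) _; rewrite !enormZ //; last lra.
have : t * enorm (x - c) <= t * r by apply: ler_wpM2l.
have : (1 - t) * enorm (y - c) <= (1 - t) * r by apply: ler_wpM2l => //; lra.
lra.
Qed.

Lemma closureP K z :
  closure K z <-> forall e, 0 < e -> exists2 a, K a & enorm (a - z) < e.
Proof.
rewrite -[K in closure K]setCK closure_setC; split=> [nint e e0|Kz].
  apply: contrapT => nK; apply: nint; apply/interiorP; exists e => // y ye Ky.
  by apply: nK; exists y.
move=> /interiorP[e e0 eK]; have [a Ka ae] := Kz e e0.
exact: eK ae Ka.
Qed.

Lemma closure_convex K : convex_set K -> convex_set (closure K).
Proof.
move=> /convex_setP cK; apply/convex_setP => x y t t0 t1.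
move=> /closureP Kx /closureP Ky; apply/closureP => e e0.
have e20 : 0 < e / 2 by lra.
have [a Ka ae] := Kx _ e20; have [b Kb be] := Ky _ e20.
exists (t *: a + (1 - t) *: b); first exact: cK.
have -> : t *: a + (1 - t) *: b - (t *: x + (1 - t) *: y) =
    t *: (a - x) + (1 - t) *: (b - y).
  by rewrite !scalerBr opprD addrACA.
apply: le_lt_trans (enorm_triangle _ _) _.
rewrite !enormZ //; last lra.
have : t * enorm (a - x) <= t * (e / 2) by apply: ler_wpM2l => //; exact: ltW.
have : (1 - t) * enorm (b - y) <= (1 - t) * (e / 2).
  by apply: ler_wpM2l; [lra|exact: ltW].
lra.
Qed.

(** A small step from an interior point along the normal stays in [K] and would
cross the hyperplane. *)
Lemma interior_lt_supporting K v (b : R) k : v != 0 ->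
  K `<=` halfspace v b -> interior K k -> dot v k < b.
Proof.
move=> v0 Kv /interiorP[r r0 rK].
have ev0 : 0 < enorm v by rewrite enorm_gt0.
have /Kv : K (k + (r / 2 / enorm v) *: v).
  apply: rK; rewrite addrAC subrr add0r enormZ; last by apply: divr_ge0; lra.
  by rewrite divfK ?gt_eqF //; lra.
rewrite /halfspace /= dotDr dotZr.
have : 0 < r / 2 / enorm v * dot v v.
  by rewrite mulr_gt0 ?dot_gt0 // divr_gt0 //; lra.
lra.
Qed.

End ConvexSets.

(** * Strict separation by a tangent hyperplane *)

Section Separation.
Variables (R : realType) (d : nat).
Local Notation V := 'rV[R]_d.
Implicit Types (x y z u v w c p q h : V) (K C : set V).

(** The tangent plane at a boundary point [q + w] of a ball inside [K] supports
[K].  If some [y] of [K] were beyond it, the line from [y] through [q + w] would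
continue into the open ball; then [q + w], lying between [y] and an interior
point, would be interior to [K]. *)
Lemma touching_ball_halfspace K q w r : convex_set K ->
  (forall y, enorm (y - q) <= r -> K y) -> 0 < r -> enorm w <= r ->
  ~ interior K (q + w) -> K `<=` halfspace w (dot w (q + w)).
Proof.
move=> /convex_setP cK ballK r0 wr nint y Ky; rewrite /halfspace /= leNgt.
apply/negP => lt_wy; apply: nint.
have [g gE] : exists g, g = y - (q + w) by eexists.
pose D := dot w g; pose N := dot g g.
have D0 : 0 < D by rewrite /D gE dotDr dotNr subr_gt0.
have N0 : 0 <= N := dot_ge0 g.
(* Small enough for the point beyond [q + w] to be closer to [q] than [r]. *)
have [s [s0 sN]] : exists s, 0 < s /\ s * N < D.
  exists (D / (N + 1)); split; first by apply: divr_gt0 => //; lra.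
  rewrite mulrAC ltr_pdivrMr; last lra.
  by rewrite ltr_pM2l //; lra.
have s1 : 1 + s != 0 by apply/eqP; lra.
pose o := (1 + s)^-1 *: (q + s *: y).
(* [x |-> (1 + s) x - s y] is the homothety of centre [y] taking [q + w] into
   the open ball. *)
have phi x : (1 + s) *: x - s *: y - q = (1 + s) *: (x - o).
  rewrite scalerBr scalerA divff // scale1r opprD addrA.
  by rewrite -[in LHS]addrA [in LHS](addrC (- (s *: y))) addrA.
have : nbhs (q + w)
    [set x : V | dot (x - o) (x - o) < r * r / ((1 + s) * (1 + s))].
  apply: open_nbhs_nbhs; split; first exact: open_eball.
  rewrite /= ltr_pdivlMr; last by apply: mulr_gt0; lra.
  have -> : dot (q + w - o) (q + w - o) * ((1 + s) * (1 + s)) =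
            dot (w - s *: g) (w - s *: g).
    have -> : w - s *: g = (1 + s) *: (q + w - o).
      rewrite -phi gE scalerBr scalerDl scale1r; set a := s *: _; set b := s *: _.
      by apply/rowP => i; rewrite !mxE; ring.
    by rewrite !dotE; ring.
  rewrite !dotE (dotC g w) -/D -/N; rewrite (enorm_le_sqr _ (ltW r0)) in wr.
  have H1 : s * (s * N) < s * D by rewrite ltr_pM2l.
  have H2 : 0 < s * D by exact: mulr_gt0.
  lra.
apply: filterS => x /= xr.
have -> : x = (s / (1 + s)) *: y + (1 - s / (1 + s)) *: ((1 + s) *: x - s *: y).
  have -> : 1 - s / (1 + s) = (1 + s)^-1 by field.
  rewrite scalerBr !scalerA mulVf // scale1r [_^-1 * s]mulrC.
  by rewrite [RHS]addrC subrK.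
apply: cK => //.
- by apply: divr_ge0; lra.
- by rewrite ler_pdivrMr; lra.
apply: ballK; rewrite phi (enorm_le_sqr _ (ltW r0)) dotZl dotZr.
move: xr; rewrite ltr_pdivlMr; last by apply: mulr_gt0; lra.
by rewrite [X in X < _ -> _]mulrC mulrA => /ltW.
Qed.

(** The ball leaves no choice for the normal: the point of the ball farthest in
the direction [v] gives [r |v| <= v.w], the case of equality in Cauchy-Schwarz. *)
Lemma touching_ball_normal K q w r v b :
  (forall y, enorm (y - q) <= r -> K y) -> 0 < r -> enorm w <= r ->
  K `<=` halfspace v b -> dot v (q + w) = b -> v = (enorm v / r) *: w.
Proof.
move=> ballK r0 wr Kv vb.
have [->|v0] := eqVneq v 0.
  by rewrite /enorm dot0r sqrtr0 mul0r scale0r.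
have ev0 : 0 < enorm v by rewrite enorm_gt0.
have /Kv : K (q + (r / enorm v) *: v).
  apply: ballK; rewrite addrAC subrr add0r (enorm_le_sqr _ (ltW r0)) !dotE.
  rewrite -enorm_sqr le_eqVlt; apply/orP; left; apply/eqP; field.
  by rewrite gt_eqF.
rewrite /halfspace /= -vb !dotE -enorm_sqr lerD2l.
have -> : r / enorm v * (enorm v * enorm v) = r * enorm v.
  by field; rewrite gt_eqF.
move=> vw; apply/eqP; rewrite -subr_eq0 -dot_eq0 eq_le dot_ge0 andbT.
have wr2 : dot w w <= r * r by rewrite -enorm_le_sqr // ltW.
rewrite !dotE (dotC w v) -enorm_sqr; set e := enorm v in ev0 vw *.
have [a [a0 ra]] : exists a, 0 < a /\ e = a * r.
  by exists (e / r); split; [exact: divr_gt0|rewrite divfK // gt_eqF].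
have -> : e / r = a by rewrite ra mulfK // gt_eqF.
rewrite ra in vw *.
have : a * (r * (a * r)) <= a * dot v w by rewrite ler_pM2l.
have : a * a * dot w w <= a * a * (r * r) by rewrite ler_pM2l // mulr_gt0.
lra.
Qed.

Lemma touching_ball_tangent K q w r : convex_set K -> closed K ->
  (forall y, enorm (y - q) <= r -> K y) -> 0 < r -> enorm w <= r ->
  ~ interior K (q + w) ->
  [/\ w != 0, K `<=` halfspace w (dot w (q + w)) &
      tangent K (hyperplane w (dot w (q + w)))].
Proof.
move=> cvK clK ballK r0 wr nint.
have Kw := @touching_ball_halfspace K q w r cvK ballK r0 wr nint.
have w0 : w != 0.
  apply/eqP => w0; apply: nint; rewrite w0 addr0.
  by apply/interiorP; exists r => // y /ltW; exact: ballK.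
split=> //; exists (q + w); split.
- by apply: ballK; rewrite addrAC subrr add0r.
- by split=> //; exists w, (dot w (q + w)).
move=> H [Hqw [v [b [v0 HE Kv]]]]; rewrite HE; rewrite HE in Hqw.
have vb : dot v (q + w) = b := Hqw.
have vE := @touching_ball_normal K q w r v b ballK r0 wr Kv vb.
rewrite -vb {2}vE dotZl {1}vE; apply: hyperplaneZ.
by rewrite mulf_neq0 ?invr_eq0 // gt_eqF // enorm_gt0.
Qed.

Lemma line_continuous q h : continuous (fun s : R => q + s *: h).
Proof.
move=> s; apply: (@cvgD _ V _ (nbhs s) _ (fun=> q) (fun s => s *: h)).
  exact: cvg_cst.
exact: scalel_continuous.
Qed.

(** Leaving a closed set is an open condition on the parameter of a line. *)
Lemma line_outside K q h t : closed K -> ~ K (q + t *: h) ->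
  exists2 e, 0 < e & forall s, `|s - t| < e -> ~ K (q + s *: h).
Proof.
move=> clK nK.
have : nbhs t ((fun s : R => q + s *: h) @^-1` ~` K).
  by apply: line_continuous; apply: open_nbhs_nbhs; split => //; exact: closed_openC.
move=> /nbhs_ballP[e /= e0 eK]; exists e => // s st.
by apply: eK; rewrite -ball_normE /ball_ /= distrC.
Qed.

(** The ball of radius [r] slides from [c] along [h].  The parameters at which it
is not inside the interior of [K], paired with a witness [w], form a compact
set; the smallest such parameter is the first contact, and by closedness of [K]
the whole ball is still in [K] at that moment. *)
Lemma first_contact K c h tau r : closed K ->
  0 <= r -> 0 < tau -> ~ K (c + tau *: h) ->
  (forall y, enorm (y - c) <= r -> interior K y) ->
  exists t w, [/\ 0 <= t, t <= tau, enorm w <= r,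
    ~ interior K (c + t *: h + w) &
    forall y, enorm (y - (c + t *: h)) <= r -> K y].
Proof.
move=> clK r0 tau0 nK ballc.
pose f (x : R * V) := c + x.1 *: h + x.2.
have fcts : continuous f.
  move=> x; apply: (@cvgD _ V _ (nbhs x) _ (fun x : R * V => c + x.1 *: h) snd).
    apply: (@continuous_comp _ _ _ fst (fun s : R => c + s *: h)).
      exact: cvg_fst.
    exact: line_continuous.
  exact: cvg_snd.
pose M := (`[0, tau]%classic `*` [set w : V | enorm (w - 0) <= r])
          `&` f @^-1` (~` interior K).
have cM : compact M.
  apply: compact_closedI.
    by apply: compact_setX; [exact: segment_compact|exact: compact_eball].
  have /continuous_closedP := fcts; apply; apply: open_closedC.
  exact: open_interior.
have M0 : M !=set0.
  exists (tau, 0); split => /=.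
    split=> /=; first by rewrite in_itv /= lexx ltW.
    by rewrite /= subr0 /enorm dot0r sqrtr0.
  by rewrite /f /setC /= addr0; move=> /interior_subset.
have fstc : continuous (fst : R * V -> R) by move=> x; exact: cvg_fst.
have [[t w] + tmin] := compact_EVT_min M0 cM (continuous_subspaceT fstc).
rewrite inE => -[[/=]]; rewrite subr0 in_itv /= => /andP[t0 ttau] wr ntw.
exists t, w; split => // y yr; apply: contrapT => nKy.
have [e e0 eK] : exists2 e, 0 < e & forall s, `|s - t| < e ->
    ~ K ((y - t *: h) + s *: h).
  by apply: line_outside => //; rewrite subrK.
have tgt0 : 0 < t.
  rewrite lt_def t0 andbT; apply/eqP => tE; apply: nKy.
  apply: interior_subset; apply: ballc.
  by rewrite tE scale0r addr0 in yr.
(* A parameter before the first contact at which the translate of [y] is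
   already outside [K]. *)
pose s := Num.max 0 (t - e / 2).
have s0 : 0 <= s by rewrite le_max lexx.
have st : s < t by rewrite gt_max tgt0 /=; lra.
have se : `|s - t| < e.
  have : t - e / 2 <= s by rewrite le_max lexx orbT.
  by rewrite ltr_norml; lra.
have : (s, y - (c + t *: h)) \in M.
  rewrite inE; split => /=.
    by split=> //=; rewrite ?subr0 // in_itv /= s0 /=; lra.
  move=> /interior_subset; rewrite /f /=.
  have -> : c + s *: h + (y - (c + t *: h)) = y - t *: h + s *: h.
    by apply/rowP => i; rewrite !mxE; ring.
  exact: eK.
by move/tmin => /=; rewrite leNgt st.
Qed.

(** A closed convex set with interior points is the intersection of its tangent
halfspaces.  Since the ball meets the boundary before the segment from [c] to
[z] leaves [K], a fixed fraction [1 - tau] of the segment remains beyond the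
contact.  The tangent functional grows along it by at least a constant times
[1 - tau], which exceeds the radius when the latter is small. *)
Lemma tangent_separation K z :
  closed K -> convex_set K -> interior K !=set0 -> ~ K z ->
  exists w b, [/\ w != 0, K `<=` halfspace w b,
    tangent K (hyperplane w b) & b < dot w z].
Proof.
move=> clK cvK [c /interiorP[rho rho0 rhoK]] nKz.
have [h zE] : exists h, z = c + h by exists (z - c); rewrite addrC subrK.
have [tau [tau0 tau1 ntau]] : exists tau, [/\ 0 < tau, tau < 1 & ~ K (c + tau *: h)].
  have [|e e0 eK] := @line_outside K c h 1 clK.
    by rewrite scale1r -zE.
  exists (Num.max (1 / 2) (1 - e / 2)); split.
  - by rewrite lt_max; apply/orP; left; lra.
  - by rewrite gt_max; apply/andP; split; lra.
  - apply: eK; rewrite ltr_norml.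
    have := le_max (1 - e/2) (1/2) (1 - e / 2); rewrite lexx orbT => H.
    have : Num.max (1 / 2) (1 - e / 2) <= 1 by rewrite ge_max; apply/andP; split; lra.
    lra.
(* [r < (1 - tau) (rho - r)] is what the final estimate needs. *)
pose r := (1 - tau) * rho / 3.
have r0 : 0 < r by rewrite /r; apply: divr_gt0 => //; apply: mulr_gt0; lra.
have rrho : r < rho / 3 by rewrite /r ltr_pM2r ?invr_gt0 // gtr_pMl; lra.
have [|t [w [t0 ttau wr nint ballK]]] := @first_contact K c h tau r clK (ltW r0) tau0 ntau.
  move=> y yr; rewrite /interior.
  have : nbhs y [set x : V | dot (x - c) (x - c) < rho * rho].
    apply: open_nbhs_nbhs; split; first exact: open_eball.
    by rewrite /= -(enorm_lt_sqr _ (ltW rho0)); lra.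
  by apply: filterS => x /= xr; apply: rhoK; rewrite (enorm_lt_sqr _ (ltW rho0)).
have [w0 Kw tgt] := touching_ball_tangent cvK clK ballK r0 wr nint.
exists w, (dot w (c + t *: h + w)); split => //.
have ew0 : 0 < enorm w by rewrite enorm_gt0.
(* The ball around [c] bounds from below the growth of [w] from [c] to the
   point of contact. *)
have /Kw : K (c + (2 * rho / 3 / enorm w) *: w).
  apply: rhoK; rewrite addrAC subrr add0r (enorm_lt_sqr _ (ltW rho0)) !dotE -enorm_sqr.
  have -> : 2 * rho / 3 / enorm w * (2 * rho / 3 / enorm w * (enorm w * enorm w)) = 4 / 9 * (rho * rho).
    by field; rewrite gt_eqF.
  have : 0 < rho * rho by exact: mulr_gt0.
  lra.
rewrite zE /halfspace /= !dotE -enorm_sqr; set e := enorm w in ew0 wr *.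
have -> : 2 * rho / 3 / e * (e * e) = 2 * rho / 3 * e by field; rewrite gt_eqF.
set W := dot w h; rewrite -addrA lerD2l => HW.
rewrite ltrD2l.
have eer : e * e <= r * e by rewrite ler_pM2r.
have re : r * e < rho / 3 * e by rewrite ltr_pM2r.
have re0 : 0 < rho / 3 * e by apply: mulr_gt0 => //; lra.
have H1 : rho / 3 * e < t * W by lra.
have W0 : 0 < W.
  by rewrite ltNge; apply/negP => W0; have := mulr_ge0_le0 t0 W0; lra.
have tW : t * W <= tau * W by rewrite ler_pM2r.
have H2 : rho / 3 * e < W.
  by have : tau * W < 1 * W; [rewrite ltr_pM2r|lra].
have H3 : r * e < (1 - tau) * W.
  have : (1 - tau) * (rho / 3 * e) < (1 - tau) * W by rewrite ltr_pM2l; lra.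
  by rewrite /r; lra.
lra.
Qed.

End Separation.

(** * Comparison of depths *)

Section Depth.
Variables (R : realType) (d : nat).
Local Notation V := 'rV[R]_d.
Implicit Types (F G : set (set V)) (A S : set V) (x : V).

Lemma measurable_closed A : closed A -> measurable (A : set (borel_rV R d)).
Proof.
move=> clA; rewrite -(setCK A); apply: measurableC.
by apply: sub_sigma_algebra; exact: closed_openC.
Qed.

(** Monotonicity of [P]: a smaller set of [G] inside each set of [F]. *)
Lemma depth_le_sub (P : probability (borel_rV R d) R) F G x :
  (forall A, F A -> A x -> measurable (A : set (borel_rV R d)) /\
     exists S, [/\ G S, S x, closed S & S `<=` A]) ->
  (depth P G x <= depth P F x)%E.
Proof.
move=> FG; apply: le_ereal_inf_tmp => _ [A [FA Ax] <-].
have [mA [S [GS Sx clS SA]]] := FG A FA Ax.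
apply: (@le_trans _ _ (P S)).
  by apply: ereal_inf_lbound; exists S.
by apply: le_measure => //; rewrite inE //; exact: measurable_closed.
Qed.

(** Continuity of [P] from above along the complements of the sets [I n], which
decrease to [S]. *)
Lemma depth_le_exhaustion (P : probability (borel_rV R d) R) F G x :
  (forall S, F S -> S x -> exists I : (set V)^nat,
     [/\ forall n, closed (I n), forall n, I n `<=` I n.+1,
         ~` S = \bigcup_n I n & forall n, G (~` I n)]) ->
  (depth P G x <= depth P F x)%E.
Proof.
move=> FG; apply: le_ereal_inf_tmp => _ [S [FS Sx] <-].
have [I [clI ndI SI GI]] := FG S FS Sx.
have mIC n : measurable (~` I n : set (borel_rV R d)).
  by apply: measurableC; exact: measurable_closed.
have SE : S = \bigcap_n ~` I n by rewrite -setC_bigcup -SI setCK.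
have mS : measurable (\bigcap_n ~` I n : set (borel_rV R d)).
  exact: bigcap_measurable.
have cvgP : P (~` I n) @[n --> \oo] --> P S.
  rewrite [in P S]SE; apply: nonincreasing_cvg_mu => //.
    by rewrite (le_lt_trans (probability_le1 _ _)) // ltry.
  apply/nonincreasing_seqP => n; apply/subsetPset.
  exact: subsetC.
apply: (cvge_ge _ cvgP); apply: nearW => n; apply: ereal_inf_lbound; exists (~` I n) => //; split=> //.
by move: Sx; rewrite SE; apply.
Qed.

End Depth.

(** * Tangent halfspaces of a cone as unions of intervals *)

Section Cones.
Variables (R : realType) (d : nat).
Local Notation V := 'rV[R]_d.
Implicit Types (x y z u v w p q h k : V) (K C : set V).

Variable K : set V.
Hypotheses (clK : closed K) (cvK : convex_set K) (coneK : cone K).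
Hypothesis intK : interior K !=set0.

Lemma cone_add x y : K x -> K y -> K (x + y).
Proof.
move=> Kx Ky.
have -> : x + y = 2 *: (2^-1 *: x + (1 - 2^-1) *: y).
  have -> : 1 - 2^-1 = 2^-1 :> R by field.
  by rewrite -scalerDr scalerA divff // scale1r.
apply: coneK => //; move/convex_setP: cvK; apply => //.
lra.
Qed.

Lemma cone0 : K 0.
Proof.
have [k /interior_subset Kk] := intK.
by rewrite -(scale0r k); exact: coneK.
Qed.

(** Values of a linear functional on a ray are nonpositive or unbounded above. *)
Lemma cone_bounded_le0 C w b : cone C -> C `<=` halfspace w b ->
  C `<=` halfspace w 0.
Proof.
move=> coneC Cb y Cy; rewrite /halfspace /= leNgt; apply/negP => wy.
have Cb' t : 0 <= t -> t * dot w y <= b.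
  by move=> t0; rewrite -dotZr; apply: Cb; exact: coneC.
have b0 : 0 <= b by have := Cb' 0 (lexx _); rewrite mul0r.
have := Cb' ((b + 1) / dot w y) _.
rewrite divfK ?gt_eqF // => H.
suff : b + 1 <= b by lra.
by apply: H; apply: divr_ge0; lra.
Qed.

(** Let [A] be the union of the cones [K - t y0].  A closed halfspace containing
[A] supports [K] at [y0], so it is the tangent one, and by separation [v < 0]
implies membership in the closure of [A].  Membership in [A] itself follows by
first moving [z] back along an interior direction [k] of [K] and then using the
ball around [k] to absorb the error of approximation. *)
Lemma tangent_recession y0 v z : K y0 -> v != 0 -> dot v y0 = 0 ->
  K `<=` halfspace v 0 ->
  (forall H, supporting K y0 H -> H = hyperplane v 0) ->
  dot v z < 0 -> exists2 t, 0 <= t & K (z + t *: y0).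
Proof.
move=> Ky0 v0 vy0 Kv uniq_v vz.
pose A := [set a : V | exists2 t, 0 <= t & K (a + t *: y0)].
have KA : K `<=` A by move=> x Kx; exists 0; rewrite ?scale0r ?addr0.
have coneA : cone A.
  move=> s a s0 [t t0 Kt]; exists (s * t); first exact: mulr_ge0.
  by rewrite -scalerA -scalerDr; exact: coneK.
have cvA : convex_set A.
  apply/convex_setP => a b s s0 s1 [t t0 Kt] [t' t'0 Kt'].
  exists (s * t + (1 - s) * t').
    by rewrite addr_ge0 // mulr_ge0 //; lra.
  rewrite [(s * t + _) *: _]scalerDl addrACA -!scalerA -!scalerDr.
  by apply: cone_add; apply: coneK => //; lra.
have clA z' : dot v z' < 0 -> closure A z'.
  move=> vz'; apply: contrapT => nAz.
  have [k intk] := intK.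
  have intA : interior (closure A) !=set0.
    exists k; apply: (interiorS _ intk).
    by apply: subset_trans KA _; exact: subset_closure.
  have [w [b [w0 Aw _ bw]]] :=
    tangent_separation (@closed_closure _ A) (closure_convex cvA) intA nAz.
  have {}Aw : A `<=` halfspace w b by apply: subset_trans Aw; exact: subset_closure.
  have b0 : 0 <= b.
    by have := Aw 0 (KA _ cone0); rewrite /halfspace /= dot0r.
  have {}Aw := cone_bounded_le0 coneA Aw.
  have wy0 : dot w y0 = 0.
    apply/eqP; rewrite eq_le (Aw _ (KA _ Ky0)) /=.
    have : A (- y0) by exists 1; rewrite // scale1r addNr; exact: cone0.
    by move/Aw; rewrite /halfspace /= dotNr; lra.
  have : hyperplane w 0 = hyperplane v 0 :> set V.
    apply: uniq_v; split => //; exists w, 0; split => //.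
    exact: subset_trans KA Aw.
  move=> /(hyperplane_eq w0 v0)[a [a0 wE _]].
  have := interior_lt_supporting v0 Kv intk.
  have := Aw _ (KA _ (interior_subset intk)).
  move: bw; rewrite /halfspace /= wE !dotZl => bw ak vk.
  nra.
have [k /[dup] intk /interiorP[r r0 rK]] := intK.
have vk := interior_lt_supporting v0 Kv intk.
(* Moving back by [eta k] halves the value of [v] at [z]. *)
pose eta := dot v z / (2 * dot v k).
have eta0 : 0 < eta.
  by rewrite /eta -mulrNN -invrN mulr_gt0 ?invr_gt0; lra.
have vz' : dot v (z - eta *: k) < 0.
  rewrite !dotE /eta.
  have -> : dot v z / (2 * dot v k) * dot v k = dot v z / 2.
    by field; rewrite lt_eqF.
  lra.
have /closureP /(_ (eta * r)) [|a [t t0 Kt] ar] := clA _ vz'.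
  exact: mulr_gt0.
exists t => //.
have -> : z + t *: y0 = (a + t *: y0) + eta *: (k - eta^-1 *: (a - (z - eta *: k))).
  rewrite scalerBr scalerA divff ?gt_eqF // scale1r.
  by apply/rowP => i; rewrite !mxE; ring.
apply: cone_add => //; apply: coneK; first exact: ltW.
apply: rK; rewrite addrAC subrr add0r enormN enormZ ?invr_ge0 ?(ltW eta0) //.
by rewrite mulrC ltr_pdivrMr // mulrC.
Qed.

(** On a cone the constant of a tangent hyperplane is [0], and the tangency point
[y0] is a direction along which every point of the open halfspace enters [K]. *)
Lemma tangent_cone u b : u != 0 -> tangent K (hyperplane u b) ->
  exists a v y0, [/\ [/\ a != 0, v != 0, u = a *: v & b = 0],
    [/\ K y0, dot v y0 = 0 & K `<=` halfspace v 0] &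
    forall z, dot v z < 0 -> exists2 t, 0 <= t & K (z + t *: y0)].
Proof.
move=> u0 [y0 [Ky0 [uy0 [v [c [v0 E Kv]]]] uniq_v]].
have [a [a0 uE bE]] := hyperplane_eq u0 v0 E.
have Kv0 := cone_bounded_le0 coneK Kv.
have vy0c : dot v y0 = c by rewrite E in uy0.
have c0 : c = 0.
  apply/eqP; rewrite eq_le -{1}vy0c (Kv0 _ Ky0) /=.
  by have := Kv _ cone0; rewrite /halfspace /= dot0r.
rewrite c0 in E bE vy0c; exists a, v, y0; split.
- by split=> //; rewrite bE mulr0.
- by split.
move=> z; apply: tangent_recession => // H /uniq_v ->; exact: E.
Qed.

(** The endpoints are [b n = p + n y0 - k / (n + 1)] with [k] interior to [K]: the
first motion uses tangency at [y0], and the second one makes [v (b n)] decrease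
strictly to [v p].  Both increments are in [K], so the sets [b n - K] increase. *)
Lemma halfspace_exhaustion v y0 p : v != 0 -> K y0 -> dot v y0 = 0 ->
  K `<=` halfspace v 0 ->
  (forall z, dot v z < 0 -> exists2 t, 0 <= t & K (z + t *: y0)) ->
  exists b : nat -> V, (forall n, K (b n.+1 - b n)) /\
    forall y, dot v p < dot v y <-> exists n, K (b n - y).
Proof.
move=> v0 Ky0 vy0 Kv rec; have [k intk] := intK.
have vk := interior_lt_supporting v0 Kv intk.
have Kk := interior_subset intk.
pose b (n : nat) := p + n%:R *: y0 - n.+1%:R^-1 *: k.
have bB m n y : b n - y =
   (p - m.+1%:R^-1 *: k - y) + (n%:R *: y0 + (m.+1%:R^-1 - n.+1%:R^-1) *: k).
  by rewrite /b; apply/rowP => i; rewrite !mxE; ring.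
have le_inv (m n : nat) : (m <= n)%N -> 0 <= m.+1%:R^-1 - n.+1%:R^-1 :> R.
  by move=> mn; rewrite subr_ge0 lef_pV2 ?posrE ?ltr0n // ler_nat ltnS.
exists b; split => [n|y].
  rewrite (bB n).
  have -> : p - n.+1%:R^-1 *: k - b n = - (n%:R *: y0).
    by rewrite /b; apply/rowP => i; rewrite !mxE; ring.
  rewrite addrA -scaleNr -scalerDl addrC -natr1 addKr scale1r.
  by apply: cone_add => //; apply: coneK => //; rewrite natr1; exact: le_inv.
split=> [py|[n /Kv]]; last first.
  rewrite /halfspace /b /= !dotE vy0 mulr0.
  have : 0 < n.+1%:R^-1 * - dot v k by rewrite mulr_gt0 ?invr_gt0 ?ltr0n ?oppr_gt0.
  by rewrite mulrN; set e := _ * dot v k; lra.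
pose D := dot v y - dot v p; have D0 : 0 < D by rewrite subr_gt0.
pose m := Num.trunc (- dot v k / D).
have mD : - dot v k < m.+1%:R * D by rewrite -ltr_pdivrMr // truncnS_gt.
have [|t t0 Kt] := rec (p - m.+1%:R^-1 *: k - y).
  rewrite !dotE.
  have : m.+1%:R^-1 * - dot v k < D by rewrite mulrC ltr_pdivrMr ?ltr0n // mulrC.
  by rewrite /D mulrN; set e := _ * dot v k; lra.
pose n := maxn m (Num.trunc t).+1; exists n.
rewrite (bB m) -(subrK t n%:R) scalerDl [_ + t *: _]addrC addrA addrA.
have nt : t <= n%:R.
  apply: le_trans (ltW (truncnS_gt t)) _.
  by rewrite ler_nat leq_maxr.
apply: cone_add; first apply: cone_add => //; apply: coneK => //.
  by rewrite subr_ge0.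
by apply: le_inv; exact: leq_maxl.
Qed.

Lemma cone_interval_closed lo hi : closed (cone_interval K lo hi).
Proof.
apply: closedI.
  case: lo => [p|]; last exact: closedT.
  have : continuous (fun x : V => x - p).
    by move=> x; apply: (@cvgB _ V _ (nbhs x) _ id (fun=> p)); [exact: cvg_id|exact: cvg_cst].
  by move=> /continuous_closedP; apply.
case: hi => [p|]; last exact: closedT.
have : continuous (fun x : V => p - x).
  by move=> x; apply: (@cvgB _ V _ (nbhs x) _ (fun=> p) id); [exact: cvg_cst|exact: cvg_id].
by move=> /continuous_closedP; apply.
Qed.

End Cones.

Section ConeDepth.
Variables (R : realType) (d : nat).
Local Notation V := 'rV[R]_d.
Implicit Types (x y z u v w p q h k : V).
Variables (K : set V) (P : probability (borel_rV R d) R) (x : V).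
Hypotheses (clK : closed K) (cvK : convex_set K) (intK : interior K !=set0).

(** A point outside an interval violates one of the two endpoint conditions; the
halfspace parallel to the tangent hyperplane that separates [x - a] or [b - x]
from [K], with [x] on its border, misses the interval. *)
Lemma tangent_depth_le :
  (depth P (tangent_halfspaces K) x <= depth P (complements (cone_intervals K)) x)%E.
Proof.
apply: depth_le_sub => _ [_ [lo [hi ->]] <-] nIx; split.
  by apply: measurableC; apply: measurable_closed; exact: cone_interval_closed.
have [[a loE nKx]|[b hiE nKx]] : (exists2 a, lo = Some a & ~ K (x - a)) \/
    (exists2 b, hi = Some b & ~ K (b - x)).
  case/not_andP: nIx; first by case: lo => // a nK; left; exists a.
  by case: hi => // b nK; right; exists b.
- have [w [b [w0 Kw tgt bw]]] := tangent_separation clK cvK intK nKx.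
  exists (halfspace (- w) (- dot w x)); split.
  + apply: (@tangent_halfspaces_shift _ _ _ _ (- b)); first by rewrite oppr_eq0.
    by rewrite -(scaleN1r w) -(mulN1r b) hyperplaneZ // oppr_eq0 oner_eq0.
  + by rewrite /halfspace /= dotNl.
  + exact: halfspace_closed.
  rewrite loE => y; rewrite /halfspace /= dotNl lerN2 => xy [/Kw + _].
  rewrite /halfspace /= dotDr dotNr; move: bw; rewrite dotDr dotNr; lra.
have [w [c [w0 Kw tgt bw]]] := tangent_separation clK cvK intK nKx.
exists (halfspace w (dot w x)); split.
+ exact: tangent_halfspaces_shift w0 tgt.
+ by rewrite /halfspace /=.
+ exact: halfspace_closed.
rewrite hiE => y; rewrite /halfspace /= => xy [_ /Kw].
rewrite /halfspace /= dotDr dotNr; move: bw; rewrite dotDr dotNr; lra.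
Qed.

Hypothesis coneK : cone K.

(** Since intervals may have a single endpoint, [b - K] or [a + K] is used
according to the side of the tangent hyperplane on which the halfspace lies. *)
Lemma interval_depth_le :
  (depth P (complements (cone_intervals K)) x <= depth P (tangent_halfspaces K) x)%E.
Proof.
apply: depth_le_exhaustion => _ [u [b [v [u0 tgt ->]]]] _.
have [a [w [y0 [[a0 w0 uE b0] [Ky0 wy0 Kw] rec]]]] := tangent_cone cvK coneK intK u0 tgt.
have cone_trans := cone_add cvK coneK.
rewrite translate_halfspace b0 add0r uE dotZl.
have notS y : (~` halfspace (a *: w) (a * dot w v)) y <-> a * dot w v < a * dot w y.
  by rewrite /halfspace /setC /= dotZl ltNge; split; move/negP.
have [alt0|agt0] : a < 0 \/ 0 < a by move: a0; rewrite neq_lt => /orP.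
  have [c [cinc ccov]] :=
    halfspace_exhaustion cvK coneK intK (- v) w0 Ky0 wy0 Kw rec.
  exists (fun n => cone_interval K (Some (- c n)) None); split.
  - by move=> n; exact: cone_interval_closed.
  - move=> n y [/= Ky _]; split=> //; move: Ky; rewrite /cone_le !opprK => Ky.
    by rewrite -(subrK (c n) (c n.+1)) addrCA; exact: cone_trans.
  - apply/seteqP; split=> y.
      move=> /notS; rewrite ltr_nM2l // => yv.
      have /ccov[n cn] : dot w (- v) < dot w (- y) by rewrite !dotNr ltrN2.
      by exists n => //; split => //; rewrite /cone_le opprK addrC -[y]opprK.
    move=> [n _ [Ky _]]; apply/notS; rewrite ltr_nM2l //.
    rewrite -ltrN2 -!dotNr; apply/ccov; exists n; move: Ky.
    by rewrite /cone_le !opprK addrC.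
  - by move=> n; exists (cone_interval K (Some (- c n)) None) => //; exists (Some (- c n)), None.
have [c [cinc ccov]] :=
  halfspace_exhaustion cvK coneK intK (v) w0 Ky0 wy0 Kw rec.
exists (fun n => cone_interval K None (Some (c n))); split.
- by move=> n; exact: cone_interval_closed.
- move=> n y [/= _ Ky]; split=> //; move: Ky; rewrite /cone_le => Ky.
  by rewrite -(subrK (c n) (c n.+1)) -addrA; exact: cone_trans.
- apply/seteqP; split=> y.
    by move=> /notS; rewrite ltr_pM2l // => /ccov[n cn]; exists n.
  by move=> [n _ [_ Ky]]; apply/notS; rewrite ltr_pM2l //; apply/ccov; exists n.
- by move=> n; exists (cone_interval K None (Some (c n))) => //; exists None, (Some (c n)).
Qed.

End ConeDepth.

(** * Coordinate intervals *)

Section CoordDepth.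
Variables (R : realType) (d : nat).
Local Notation V := 'rV[R]_d.
Implicit Types (x y u v : V).

Lemma dot_delta (i : 'I_d) x : dot (delta_mx 0 i) x = x 0 i.
Proof.
rewrite /dot (bigD1 i) //= !mxE !eqxx mul1r big1 ?addr0 // => j ji.
by rewrite !mxE (negbTE ji) andbF mul0r.
Qed.

Lemma delta_neq0 (i : 'I_d) : delta_mx 0 i != 0 :> V.
Proof.
by apply/eqP => /rowP /(_ i) /eqP; rewrite !mxE !eqxx oner_eq0.
Qed.

Lemma coord_interval_closed (lo hi : 'rV[\bar R]_d) : closed (coord_interval lo hi).
Proof.
rewrite (_ : coord_interval lo hi = \bigcap_(i in [set: 'I_d])
    ((fun x : V => (x 0 i)%:E) @^-1` [set e | (lo 0%R i <= e)%E] `&`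
     (fun x : V => (x 0 i)%:E) @^-1` [set e | (e <= hi 0%R i)%E])); last first.
  apply/seteqP; split=> x /= H i; first by move=> _; have /andP[] := H i.
  by apply/andP; have [] := H i I.
have cE (i : 'I_d) : continuous (fun x : V => (x 0 i)%:E).
  move=> x; apply: (@cvg_EFin R V (nbhs x) _); first exact: nearW.
  exact: coord_continuous.
apply: closed_bigI => i _; apply: closedI.
  by have /continuous_closedP := cE i; apply; exact: closed_ereal_le_ereal.
by have /continuous_closedP := cE i; apply; exact: closed_ereal_ge_ereal.
Qed.

Variables (P : probability (borel_rV R d) R) (x : V).

Lemma coord_halfspaces_scale a (i : 'I_d) b : a != 0 ->
  coord_halfspaces R d (halfspace (a *: delta_mx 0 i) (a * b)).
Proof.
move=> a0; exists (a *: delta_mx 0 i), (a * b), i; split => //.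
  by rewrite scaler_eq0 negb_or a0 delta_neq0.
exists (b *: delta_mx 0 i); rewrite hyperplaneZ //.
apply/seteqP; split=> y; rewrite /hyperplane /translate /= dot_delta !mxE !eqxx mulr1.
  by move=> ->; rewrite subrr.
by move/eqP; rewrite subr_eq0 => /eqP.
Qed.

Lemma coord_halfspace_depth_le :
  (depth P (coord_halfspaces R d) x <= depth P (complements (coord_intervals R d)) x)%E.
Proof.
apply: depth_le_sub => _ [_ [lo [hi ->]] <-] nIx; split.
  by apply: measurableC; apply: measurable_closed; exact: coord_interval_closed.
have [i] : exists i, ~ (lo 0%R i <= (x 0%R i)%:E <= hi 0%R i)%E by apply/existsNP.
move/negP; rewrite negb_and -!ltNge => /orP[xlo|xhi].
  exists (halfspace (1 *: delta_mx 0 i) (1 * x 0 i)); split.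
  - by apply: coord_halfspaces_scale; exact: oner_neq0.
  - by rewrite /halfspace /= mul1r scale1r dot_delta.
  - exact: halfspace_closed.
  move=> y; rewrite /halfspace /= mul1r scale1r dot_delta => yx /(_ i) /andP[loy _].
  have := lt_le_trans xlo loy; rewrite lte_fin; lra.
exists (halfspace (-1 *: delta_mx 0 i) (-1 * x 0 i)); split.
- by apply: coord_halfspaces_scale; rewrite oppr_eq0 oner_eq0.
- by rewrite /halfspace /= dotZl dot_delta.
- exact: halfspace_closed.
move=> y; rewrite /halfspace /= dotZl dot_delta => yx /(_ i) /andP[_ yhi].
have := le_lt_trans yhi xhi; rewrite lte_fin; lra.
Qed.

Lemma exists_invS (e : R) : 0 < e -> exists n : nat, n.+1%:R^-1 <= e.
Proof.
move=> e0; exists (Num.trunc e^-1).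
rewrite invf_ple ?posrE ?ltr0n //; exact/ltW/truncnS_gt.
Qed.

(** Only coordinate [i] of the intervals is constrained, by one endpoint at
distance [1 / (n + 1)] from the border. *)
Lemma coord_interval_depth_le :
  (depth P (complements (coord_intervals R d)) x <= depth P (coord_halfspaces R d) x)%E.
Proof.
apply: depth_le_exhaustion => _ [u [b [i [u0 -> [v E]]]]] _.
have [a [a0 -> ->]] : exists a, [/\ a != 0, u = a *: delta_mx 0 i & b = a * v 0 i].
  apply: hyperplane_eq => //; first exact: delta_neq0.
  rewrite E; apply/seteqP; split=> y; rewrite /hyperplane /translate /= dot_delta !mxE.
    by move/eqP; rewrite subr_eq0 => /eqP.
  by move=> ->; rewrite subrr.
have notS y : (~` halfspace (a *: delta_mx 0 i) (a * v 0 i)) y <-> a * v 0 i < a * y 0 i.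
  by rewrite /halfspace /setC /= dotZl dot_delta ltNge; split; move/negP.
have inv0 n : 0 < n.+1%:R^-1 :> R by rewrite invr_gt0 ltr0n.
have le_inv n : n.+2%:R^-1 <= n.+1%:R^-1 :> R.
  by rewrite lef_pV2 ?posrE ?ltr0n // ler_nat.
have [alt0|agt0] : a < 0 \/ 0 < a by move: a0; rewrite neq_lt => /orP.
  pose I n : set V := coord_interval (\row_j -oo%E)
    (\row_j if j == i then (v 0 i - n.+1%:R^-1)%:E else +oo%E).
  have IE n y : I n y <-> y 0 i <= v 0 i - n.+1%:R^-1.
    split=> [/(_ i)|yv j]; first by rewrite !mxE eqxx lee_fin => /andP[].
    rewrite !mxE leNye /=; case: eqP => [->|_]; by rewrite ?lee_fin ?leey.
  exists I; split.
  - by move=> n; exact: coord_interval_closed.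
  - by move=> n y /IE yv; apply/IE; apply: (le_trans yv); rewrite lerD2l lerN2.
  - apply/seteqP; split=> y.
      move=> /notS; rewrite ltr_nM2l // -subr_gt0 => /exists_invS[n nv].
      by exists n => //; apply/IE; move: nv; set k := _^-1; lra.
    move=> [n _ /IE yv]; apply/notS; rewrite ltr_nM2l //.
    by apply: (le_lt_trans yv); rewrite gtrBl.
  - by move=> n; exists (I n) => //; eexists; eexists.
pose I n : set V := coord_interval
  (\row_j if j == i then (v 0 i + n.+1%:R^-1)%:E else -oo%E) (\row_j +oo%E).
have IE n y : I n y <-> v 0 i + n.+1%:R^-1 <= y 0 i.
  split=> [/(_ i)|yv j]; first by rewrite !mxE eqxx lee_fin => /andP[].
  rewrite !mxE leey andbT; case: eqP => [->|_]; by rewrite ?lee_fin ?leNye.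
exists I; split.
- by move=> n; exact: coord_interval_closed.
- by move=> n y /IE yv; apply/IE; apply: le_trans yv; rewrite lerD2l.
- apply/seteqP; split=> y.
    move=> /notS; rewrite ltr_pM2l // -subr_gt0 => /exists_invS[n nv].
    by exists n => //; apply/IE; move: nv; set k := _^-1; lra.
  move=> [n _ /IE yv]; apply/notS; rewrite ltr_pM2l //.
  by apply: lt_le_trans yv; rewrite ltrDl.
- by move=> n; exists (I n) => //; eexists; eexists.
Qed.

End CoordDepth.

(** * Compact convex sets and balls *)

Section CompactConvex.
Variables (R : realType) (d : nat).
Local Notation V := 'rV[R]_d.
Implicit Types (x y u v p c : V) (C : set V).

(** The normal is the vector from [x] to its nearest point [p] in [C]: were the
angle at [p] obtuse for some [y], moving from [p] towards [y] would decrease the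
distance to [x]. *)
Lemma nearest_point_separation C x : compact C -> convex_set C -> C !=set0 ->
  ~ C x -> exists2 u, u != 0 & forall y, C y -> dot u x < dot u y.
Proof.
move=> cC /convex_setP cvC C0 nCx.
have [p + pmin] := compact_EVT_min C0 cC
  (continuous_subspaceT (@dist_sqr_continuous R d x)).
rewrite inE => Cp; have [u uE] : exists u, u = p - x by eexists.
have u0 : u != 0 by apply/eqP => u0; apply: nCx; move/eqP: u0; rewrite uE subr_eq0 => /eqP <-.
exists u => // y Cy.
have uu : 0 < dot u u by rewrite dot_gt0.
suff : 0 <= dot u (y - p).
  have -> : y - p = y - x - u by rewrite uE opprB addrA subrK.
  rewrite !dotDr !dotNr; lra.
rewrite leNgt; apply/negP.
have [g gE] : exists g, g = y - p by eexists.
rewrite -gE => D0; have N0 := dot_ge0 g.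
have [t [t0 t1 tN]] : exists t, [/\ 0 < t, t <= 1 & t * dot g g < - dot u g].
  exists (- dot u g / (dot g g - dot u g)); split.
  - by apply: divr_gt0; lra.
  - by rewrite ler_pdivrMr; lra.
  rewrite mulrAC ltr_pdivrMr; last lra.
  by rewrite ltr_pM2l; lra.
have : t *: y + (1 - t) *: p \in C by rewrite inE; apply: cvC => //; exact: ltW.
move/pmin; rewrite -uE.
have -> : t *: y + (1 - t) *: p - x = u + t *: g.
  by rewrite gE uE; apply/rowP => i; rewrite !mxE; ring.
rewrite !dotE (dotC g u).
have H1 : t * (t * dot g g) < t * - dot u g by rewrite ltr_pM2l.
have H2 : t * dot u g < 0 by rewrite pmulr_rlt0.
lra.
Qed.

(** With [e] the unit normal and [q] on the border, the balls have centres
[q + m e] and radii [m - 1 / m].  The gap [1 / m] keeps them strictly inside the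
open halfspace, and shrinks, so that the radius grows by more than the centre
moves. *)
Lemma ball_exhaustion u b : u != 0 ->
  exists (c : nat -> V) (r : nat -> R), [/\ forall n, 0 < r n,
    forall n y, enorm (y - c n) <= r n -> enorm (y - c n.+1) <= r n.+1 &
    forall y, b < dot u y <-> exists n, enorm (y - c n) <= r n].
Proof.
move=> u0; have eu0 : 0 < enorm u by rewrite enorm_gt0.
have uu0 : 0 < dot u u by rewrite dot_gt0.
have [e [uE ee]] : exists e, u = enorm u *: e /\ enorm e = 1.
  exists ((enorm u)^-1 *: u); split.
    by rewrite scalerA divff ?scale1r // gt_eqF.
  by rewrite enormZ ?invr_ge0 ?enorm_ge0 // mulVf // gt_eqF.
have ee1 : dot e e = 1 by rewrite -enorm_sqr ee mulr1.
have [q eq] : exists q, dot e q = b / enorm u.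
  by exists ((b / enorm u) *: e); rewrite dotZr ee1 mulr1.
have bE y : (b < dot u y) = (0 < dot e (y - q)).
  by rewrite {1}uE dotZl dotDr dotNr eq subr_gt0 ltr_pdivrMr // mulrC.
pose c (n : nat) := q + n.+2%:R *: e.
(* The index starts at [2] because the radius [m - 1 / m] vanishes at [m = 1]. *)
pose r (n : nat) : R := n.+2%:R - n.+2%:R^-1.
have m0 n : 0 < n.+2%:R :> R by rewrite ltr0n.
have r0 n : 0 < r n.
  rewrite subr_gt0; apply: (@lt_trans _ _ 1).
    by rewrite invf_lt1 ?ltr1n.
  by rewrite ltr1n.
exists c, r; split=> // [n y yr|y].
  have -> : y - c n.+1 = (y - c n) - e.
    by rewrite /c -(natr1 n.+2); apply/rowP => i; rewrite !mxE; ring.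
  apply: le_trans (enorm_triangle _ _) _; rewrite enormN ee.
  apply: (@le_trans _ _ (r n + 1)); first by rewrite lerD2r.
  rewrite /r -(natr1 n.+2) addrAC lerD2l lerN2 natr1 lef_pV2 ?posrE //.
  by rewrite ler_nat.
rewrite bE; split=> [D0|[n yr]].
  have [z zE] : exists z, z = y - q by eexists.
  rewrite -zE in D0.
  (* [|z|^2 + 2 <= 2 m (e.z)] implies [|z - m e| <= m - 1 / m]. *)
  pose n := Num.trunc ((dot z z + 2) / (2 * dot e z)).
  have : (dot z z + 2) / (2 * dot e z) < n.+2%:R.
    by apply: (lt_trans (truncnS_gt _)); rewrite ltr_nat.
  rewrite ltr_pdivrMr ?mulr_gt0 // => nz.
  exists n; rewrite (enorm_le_sqr _ (ltW (r0 n))).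
  have -> : y - c n = z - n.+2%:R *: e by rewrite zE /c opprD addrA.
  rewrite !dotE (dotC z e) ee1 /r.
  move: (m0 n) nz; set m := n.+2%:R => m_gt0 nz.
  have -> : (m - m^-1) * (m - m^-1) = m * m - 2 + m^-1 * m^-1.
    by field; rewrite gt_eqF.
  have : 0 < m^-1 * m^-1 by rewrite mulr_gt0 ?invr_gt0.
  set k := m^-1 * m^-1; lra.
have : dot e (c n - y) <= r n.
  apply: le_trans (dot_le_enorm _ _) _.
  by rewrite ee mul1r -enormN opprB.
have -> : c n - y = n.+2%:R *: e - (y - q).
  by rewrite /c; apply/rowP => i; rewrite !mxE; ring.
have : 0 < n.+2%:R^-1 :> R by rewrite invr_gt0.
rewrite !dotE ee1 mulr1 /r; set k := _^-1; lra.
Qed.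

Hypothesis d_gt0 : (0 < d)%N.
Variables (P : probability (borel_rV R d) R) (x : V).

Lemma halfspace_depth_le_compact :
  (depth P (closed_halfspaces R d) x <= depth P (complements (compact_convex_sets R d)) x)%E.
Proof.
apply: depth_le_sub => _ [C [cC cvC] <-] nCx; split.
  apply: measurableC; apply: measurable_closed.
  exact: compact_closed (@norm_hausdorff R V) cC.
have [u u0 uC] : exists2 u, u != 0 & forall y, C y -> dot u x < dot u y.
  (* Any nonzero vector serves for the empty set. *)
  have [->|/set0P C0] := eqVneq C set0; last exact: nearest_point_separation.
  by exists (delta_mx 0 (Ordinal d_gt0)) => //; exact: delta_neq0.
exists (halfspace u (dot u x)); split.
- by exists u, (dot u x).
- by rewrite /halfspace /=.
- exact: halfspace_closed.
by move=> y; rewrite /halfspace /= leNgt => /negP yx /uC.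
Qed.

Lemma compact_depth_le_ball :
  (depth P (complements (compact_convex_sets R d)) x <=
   depth P (complements (closed_euclidean_balls R d)) x)%E.
Proof.
apply: ereal_inf_le_tmp => _ [_ [[C [c [r [r0 ->]]] <-] nCx] <-].
exists (~` [set y | enorm (y - c) <= r]) => //; split => //.
exists [set y | enorm (y - c) <= r] => //; split; first exact: compact_eball.
by apply: convex_eball; exact: ltW.
Qed.

Lemma ball_depth_le_halfspace :
  (depth P (complements (closed_euclidean_balls R d)) x <=
   depth P (closed_halfspaces R d) x)%E.
Proof.
apply: depth_le_exhaustion => _ [u [b [u0 ->]]] _.
have [c [r [r0 inc cov]]] := @ball_exhaustion u b u0.
exists (fun n => [set y | enorm (y - c n) <= r n]); split.
- by move=> n; exact: compact_closed (@norm_hausdorff R V) (@compact_eball _ _ _ _).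
- exact: inc.
- apply/seteqP; split=> y.
    by rewrite /halfspace /setC /= => /negP; rewrite -ltNge => /cov[n yn]; exists n.
  move=> [n _ yn]; rewrite /halfspace /setC /=; apply/negP; rewrite -ltNge.
  by apply/cov; exists n.
- by move=> n; exists [set y | enorm (y - c n) <= r n] => //; exists (c n), (r n).
Qed.

End CompactConvex.

Theorem corollary5p1 (R : realType) (d : nat) (d_gt0 : (0 < d)%N) :
  (forall K : set 'rV[R]_d,
     closed K -> convex_set K -> cone K -> interior K !=set0 ->
     one_sided_cone K ->
     forall (P : probability (borel_rV R d) R) (x : 'rV[R]_d),
       depth P (complements (cone_intervals K)) x =
       depth P (tangent_halfspaces K) x)
  /\
  (forall (P : probability (borel_rV R d) R) (x : 'rV[R]_d),
     depth P (complements (coord_intervals R d)) x =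
     depth P (coord_halfspaces R d) x)
  /\
  (forall (P : probability (borel_rV R d) R) (x : 'rV[R]_d),
     depth P (closed_halfspaces R d) x =
       depth P (complements (compact_convex_sets R d)) x
     /\
     depth P (complements (compact_convex_sets R d)) x =
       depth P (complements (closed_euclidean_balls R d)) x).
Proof.
split=> [K clK cvK coneK intK _ P x|]; last split=> P x.
- by apply/eqP; rewrite eq_le interval_depth_le ?tangent_depth_le.
- by apply/eqP; rewrite eq_le coord_interval_depth_le coord_halfspace_depth_le.
have hk := halfspace_depth_le_compact d_gt0 P x.
have kb := compact_depth_le_ball P x.
have bh := ball_depth_le_halfspace P x.
split; apply/eqP; rewrite eq_le.
- by rewrite hk (le_trans kb bh).
- by rewrite kb (le_trans bh hk).
Qed.
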